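(* Let $m,d$ be positive integers and $\mathbb{F}_q$ a finite field with $q$ elements such that $1\le d<q-1$. Let $k:=\binom{m+d}{d}$. Then $$e_{k-s}(d,m)=s=T_{k-s}(d,m)\quad\text{for } s=0,1,\dots,d.$$ Consequently, the Tsfasman-Boguslavsky Conjecture, i.e. the assertion $e_r(d,m)=T_r(d,m)$, holds for the last $d+1$ values of $r$, namely $r=k-s$ with $s=0,1,\dots,d$.
   Context: For an integer $k$, $p_k:=q^k+q^{k-1}+\dots+q+1$ if $k\ge 0$ and $p_k:=0$ if $k<0$. For $1\le r\le\binom{m+d}{d}$, $e_r(d,m)$ denotes the maximum number of common zeros in $\mathbb{P}^m(\mathbb{F}_q)$ of a system of $r$ linearly independent (over $\mathbb{F}_q$) homogeneous polynomials of degree $d$ in $\mathbb{F}_q[x_0,x_1,\dots,x_m]$. For $1\le r\le\binom{m+d}{d}$, define $$T_r(d,m):=p_{m-2j}+\sum_{i=j}^m\nu_i\,(p_{m-i}-p_{m-i-j}),$$ where $(\nu_1,\dots,\nu_{m+1})$ is the $r$th element in descending lexicographic order among the $(m+1)$-tuples $(\alpha_1,\dots,\alpha_{m+1})$ of nonnegative integers satisfying $\alpha_1+\cdots+\alpha_{m+1}=d$, and $j:=\min\{i:\nu_i\ne 0\}$ (an empty sum is $0$). *)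

(* Defs.v *)
From mathcomp Require Import all_boot all_order all_algebra all_field.
From mathcomp Require Export mpoly.

Set Implicit Arguments.
Unset Strict Implicit.
Unset Printing Implicit Defensive.

Import Order.TTheory GRing.Theory.
Local Open Scope ring_scope.

Definition proportional (F : finFieldType) (n : nat) (u v : 'rV[F]_n) : bool :=
  [exists a : F, (a != 0) && (v == a *: u)].

(* A point of P^m(F_q) is the set of all its homogeneous coordinate vectors. *)
Definition proj_space (F : finFieldType) (m : nat) : {set {set 'rV[F]_m.+1}} :=
  equivalence_partition (@proportional F m.+1) [set v | v != 0].

Definition common_zeros (F : finFieldType) (m d r : nat)
    (f : r.-tuple (dhomog m.+1 F d)) : {set {set 'rV[F]_m.+1}} :=
  [set P in proj_space F m |
    [forall v in P, forall i : 'I_r, (tnth f i : {mpoly F[m.+1]}).@[v 0] == 0]].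

(* [dhomog] is the F-space of homogeneous polynomials of degree d, zero        *)
(* included; [finvect_type] only supplies its finite type structure, so that   *)
(* the maximum ranges over finitely many systems. For r outside the range      *)
(* 1 <= r <= 'C(m + d, d) the value carries no meaning.                        *)
Definition max_common_zeros (F : finFieldType) (d m r : nat) : nat :=
  \max_(f : r.-tuple (finvect_type (dhomog m.+1 F d)) |
        free (f : seq (dhomog m.+1 F d)))
    #|@common_zeros F m d r f|.

Definition proj_card (q : nat) (k : int) : nat :=
  match k with
  | Posz n => (\sum_(0 <= i < n.+1) q ^ i)%N
  | Negz _ => 0%N
  end.

(* Since the entries sum to d, bounding each of them by d loses nothing. *)
Definition exponents (m d : nat) : seq (seqlexi nat) :=
  [seq map val (val t)
     | t in [pred t : m.+1.-tuple 'I_d.+1 | sumn (map val t) == d]].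

(* The r-th exponent for r >= 1: indices of sequences start at 0. *)
Definition nth_exponent (m d r : nat) : seq nat :=
  nth [::] (sort (fun a b : seqlexi nat => (b <= a)%O) (exponents m d)) r.-1.

(* nu_i in the 1-based numbering is [nth 0 nu i.-1]. *)
Definition min_index (nu : seq nat) : nat := (find (fun a => a != 0%N) nu).+1.

Definition TB (q d m r : nat) : int :=
  let nu := nth_exponent m d r in
  let j := min_index nu in
  (proj_card q (m%:Z - (2 * j)%:Z))%:Z +
  \sum_(j <= i < m.+1)
    (nth 0%N nu i.-1)%:Z *
      ((proj_card q (m%:Z - i%:Z))%:Z - (proj_card q (m%:Z - i%:Z - j%:Z))%:Z).

Definition Tsfasman_Boguslavsky (F : finFieldType) (d m r : nat) : Prop :=
  (max_common_zeros F d m r)%:Z = TB #|F| d m r.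

(* Main.v *)
(* At most d + 1 distinct points impose independent conditions on forms of
   degree d: a product of linear forms vanishes at all of them but one. Hence
   k - s independent forms with s + 1 common zeros would span a space of
   dimension at most k - s - 1, while the forms vanishing at s given points
   have dimension at least k - s; so e_(k-s) = s. On the other side, the last
   d + 1 exponents in descending lexicographic order are
   (0, ..., 0, s, d - s) for s = d, ..., 0, whence T_(k-s) = s. *)

From HB Require Import structures.
Require Import Defs.
From mathcomp Require Import all_boot all_order all_algebra all_field.

Set Implicit Arguments.
Unset Strict Implicit.
Unset Printing Implicit Defensive.

Import Order.TTheory GRing.Theory Num.Theory.

(** * The tail of the exponents in descending lexicographic order *)

Lemma mem_exponents m d (x : seqlexi nat) :
  (x \in exponents m d) = (size x == m.+1) && (sumn x == d).
Proof.
apply/imageP/andP => [[t t_d ->]|[/eqP x_sz /eqP x_d]].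
  by rewrite size_map size_tuple eqxx.
pose s := [seq inord i : 'I_d.+1 | i <- x].
have s_sz : size s == m.+1 by rewrite size_map x_sz.
have s_x : map val s = x.
  rewrite -map_comp map_id_in // => i i_x /=.
  by rewrite inordK // ltnS -x_d sumnE (big_rem i) //= leq_addr.
by exists (Tuple s_sz); rewrite ?inE /= s_x ?x_d.
Qed.

Lemma uniq_exponents m d : uniq (exponents m d).
Proof.
rewrite map_inj_uniq ?enum_uniq // => t u tu.
by apply/val_inj/(inj_map val_inj).
Qed.

Lemma size_exponents m d : size (exponents m d) = 'C(m + d, d).
Proof.
rewrite size_map -cardE -bin_sub ?leq_addl // addnK -card_ord_partitions cardsE.
by apply: eq_card => t; rewrite !inE sumnE big_map.
Qed.

(** Indexed by the last entry, so that increasing [i] descends lexicographically; the length n + 2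
    is m + 1 for m = n + 1. *)
Definition low_exponent n d i : seqlexi nat := ncons n 0 [:: d - i; i].

(** A nonzero entry among the first [n] puts [x] above every low exponent; if these entries all
    vanish, the sum condition leaves only the last entry free. *)
Lemma low_exponentP n d (x : seqlexi nat) :
  size x = n.+2 -> sumn x = d ->
  (exists2 i, i <= d & x = low_exponent n d i) \/
  (forall i, i <= d -> (low_exponent n d i <= x)%O).
Proof.
elim: n x => [|n IHn] [|a x] //=.
  case: x => [|b []] //= _; rewrite addn0 => <-.
  by left; exists b; rewrite ?leq_addl // /low_exponent /= addnK.
move=> [x_sz] x_d; case: (posnP a) => [a0|a_gt0]; last first.
  right=> i i_le; rewrite /low_exponent /= lexi_cons leEnat leq0n /=.
  by rewrite leqNgt a_gt0.
rewrite a0 add0n in x_d *; case: (IHn x x_sz x_d) => [[i i_le ->]|x_ge].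
  by left; exists i.
by right=> i i_le; rewrite /low_exponent /= lexi_cons lexx /=; apply: x_ge.
Qed.

Lemma le_low_exponent n d i j : i <= d -> j <= d ->
  (low_exponent n d i <= low_exponent n d j)%O = (j <= i).
Proof.
move=> i_le j_le; elim: n => [|n IHn]; last first.
  by rewrite /low_exponent /= lexi_cons lexx.
rewrite /low_exponent /= !lexi_cons !leEnat /= lexx implybT andbT.
by rewrite !leq_sub2lE // implybb andbT.
Qed.

Lemma low_exponent_inj n d : injective (low_exponent n d).
Proof.
move=> i j /(congr1 (last 0)).
by rewrite /low_exponent -!cat_nseq !last_cat.
Qed.

Lemma nth_exponent_low n d s : s <= d ->
  nth_exponent n.+1 d ('C(n.+1 + d, d) - s) = low_exponent n d (d - s).
Proof.
move=> s_le; rewrite /nth_exponent.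
set ge := fun a b : seqlexi nat => (b <= a)%O; set L := exponents n.+1 d.
have ge_tr : transitive ge by move=> y x z xy yz; apply: le_trans xy.
have ge_anti : antisymmetric ge by move=> x y; rewrite andbC; apply: le_anti.
have ge_total : total ge by move=> x y; apply: le_total.
pose E := mkseq (low_exponent n d) d.+1.
have E_mem x : x \in E -> exists2 i, i <= d & x = low_exponent n d i.
  by case/mapP=> i; rewrite mem_iota ltnS => /= i_le ->; exists i.
have E_sorted : pairwise ge E.
  rewrite pairwise_map; apply: (@sub_in_pairwise _ (fun i => i <= d) leq).
  - by move=> i j i_le j_le; rewrite /= /ge le_low_exponent.
  - by apply/allP=> i; rewrite mem_iota ltnS.
  - by rewrite -sorted_pairwise ?iota_sorted //; apply: leq_trans.
have E_uniq : uniq E.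
  by rewrite map_inj_uniq ?iota_uniq //; apply: low_exponent_inj.
have E_sub : {subset E <= L}.
  move=> x /E_mem[i i_le ->]; rewrite mem_exponents /low_exponent size_ncons.
  rewrite addn2 eqxx /=; elim: (n) => [|n' IHn] //=.
  by rewrite addn0 subnK.
pose R := filter (predC (mem E)) L.
have perm_L : perm_eq L (R ++ E).
  rewrite -(perm_filterC (predC (mem E))) perm_cat2l.
  apply: uniq_perm => [||x]; rewrite ?filter_uniq ?uniq_exponents //.
  by rewrite mem_filter /= negbK andb_idr //; apply: E_sub.
(* Both sides are sorted permutations of [L]: [E] is already descending, and every tuple of [R] lies
   above all of [E]. *)
have -> : sort ge L = sort ge R ++ E.
  apply: (sorted_eq ge_tr ge_anti); rewrite ?sort_sorted //.
    rewrite sorted_pairwise // pairwise_cat E_sorted andbT.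
    rewrite -sorted_pairwise // sort_sorted // andbT.
    apply/allrelP=> x y; rewrite mem_sort mem_filter => /andP[/= xE xL].
    case/E_mem=> i i_le ->; move: xL; rewrite mem_exponents.
    case/andP=> /eqP x_sz /eqP x_d.
    case: (low_exponentP x_sz x_d) => [[j j_le x_j]|]; last exact.
    by case/negP: xE; rewrite x_j map_f // mem_iota ltnS.
  by rewrite perm_sort (permPl perm_L) perm_cat2r perm_sym perm_sort.
have := perm_size perm_L.
rewrite size_exponents size_cat size_mkseq => ->.
(* The 0-based index is [size R + (d - s)], hence position [d - s] within [E]. *)
rewrite nth_cat size_sort addnS subSn ?(leq_trans s_le) ?leq_addl //=.
rewrite -addnBA // ltnNge leq_addr addKn nth_mkseq //.
by rewrite ltnS leq_subr.
Qed.

(** * The value of the Tsfasman-Boguslavsky formula *)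

Lemma proj_card_lt0 q (k : int) : (k < 0)%R -> proj_card q k = 0.
Proof. by case: k. Qed.

Lemma TB_last q n d s : s <= d -> TB q d n.+1 ('C(n.+1 + d, d) - s) = Posz s.
Proof.
move=> s_le; rewrite /TB nth_exponent_low // /low_exponent subKn //.
rewrite -cat_nseq /min_index find_cat has_nseq eqxx andbF size_nseq.
set j := (n + _).+1; have n_lt_j : n < j by rewrite ltnS leq_addr.
rewrite proj_card_lt0 ?add0r; last first.
  by rewrite subr_lt0 ltz_nat (leq_ltn_trans n_lt_j) // ltn_Pmull.
(* For s = 0 the first nonzero index [j] exceeds m = n + 1 and the sum is empty. For s > 0, j = m,
   and the only term is s (p_0 - p_(-m)) = s. *)
case: (posnP s) => [s0|s_gt0].
  by rewrite big_geq ?s0 // /j s0 /= addnS ltnS leq_addr.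
have -> : j = n.+1 by rewrite /j /= -lt0n s_gt0 addn0.
rewrite big_nat1 /= nth_cat size_nseq ltnn subnn /= subrr.
rewrite (proj_card_lt0 _ (_ : (0 - _ < 0)%R)) ?sub0r ?oppr_lt0 //.
by rewrite subr0 /= big_nat1 expn0 mulr1.
Qed.

Local Open Scope ring_scope.

(** * Proportional vectors and separating forms *)

Lemma proportional_refl (F : finFieldType) n : reflexive (@proportional F n).
Proof.
by move=> u; apply/existsP; exists 1; rewrite oner_neq0 scale1r eqxx.
Qed.

Lemma proportional_left_trans (F : finFieldType) n :
  left_transitive (@proportional F n).
Proof.
move=> u v /existsP[a /andP[a_nz /eqP ->]] w.
apply/existsP/existsP=> -[b /andP[b_nz /eqP ->]].
  exists (b / a); rewrite mulf_neq0 ?invr_eq0 //=.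
  by rewrite scalerA divfK.
by exists (b * a); rewrite mulf_neq0 //= scalerA.
Qed.

(** Makes vanishing at a projective point independent of the representative. *)
Lemma mevalZ_homog (F : fieldType) n d (p : dhomog n F d) a (v : 'rV[F]_n) :
  (p : {mpoly F[n]}).@[(a *: v) 0] = a ^+ d * (p : {mpoly F[n]}).@[v 0].
Proof.
rewrite !mevalE mulr_sumr; apply: eq_big_seq => e e_p.
have /dhomogP/(_ _ e_p) e_d := dhomog_is_dhomog p.
rewrite mulrCA; congr (_ * _).
rewrite (eq_bigr (fun i => a ^+ e i * v 0 i ^+ e i)); last first.
  by move=> i _; rewrite mxE exprMn.
by rewrite big_split /= prodrXr -mdegE e_d.
Qed.

(** Fix [i] with [u 0 i] nonzero. If all 2 x 2 minors of the rows [u], [v] through column [i]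
    vanished, [v] would be a multiple of [u]; a nonzero minor is the value at [v] of a linear form
    killing [u]. *)
Lemma sep_linear_form (F : finFieldType) n (u v : 'rV[F]_n) :
    u != 0 -> v != 0 -> ~~ proportional u v ->
  exists L : dhomog n F 1,
    (L : {mpoly F[n]}).@[u 0] = 0 /\ (L : {mpoly F[n]}).@[v 0] != 0.
Proof.
move=> u_nz v_nz uv.
have [i u_i] : exists i, u 0 i != 0 by apply/rV0Pn.
have [j uv_ij] : exists j, u 0 i * v 0 j - u 0 j * v 0 i != 0.
  apply/existsP; apply: contraNT uv => /existsPn uv_0.
  have v_u : v = (v 0 i / u 0 i) *: u.
    apply/rowP=> j; rewrite mxE; apply: (mulfI u_i); have := uv_0 j.
    rewrite negbK subr_eq0 => /eqP ->.
    by rewrite mulrA [u 0 i * _]mulrC divfK // mulrC.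
  apply/existsP; exists (v 0 i / u 0 i); rewrite -v_u eqxx andbT.
  by apply: contraNneq v_nz => c0; rewrite v_u c0 scale0r.
pose p : {mpoly F[n]} := u 0 i *: 'X_j - u 0 j *: 'X_i.
have p_homog : p \is 1.-homog.
  by rewrite rpredB ?dhomogZ ?dhomogX /= ?mdeg1.
exists (DHomog p_homog); rewrite /= /p !mevalB !mevalZ !mevalXU.
by rewrite mulrC subrr.
Qed.

(* Each point of [us] is killed by its own linear factor; the remaining factors
   only pad the degree. *)
Lemma sep_form (F : finFieldType) n d (us : seq 'rV[F]_n) (v : 'rV[F]_n) :
    (size us <= d)%N -> v != 0 ->
    {in us, forall u : 'rV_n, u != 0 /\ ~~ proportional u v} ->
  exists g : dhomog n F d, (g : {mpoly F[n]}).@[v 0] != 0 /\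
    {in us, forall u : 'rV_n, (g : {mpoly F[n]}).@[u 0] = 0}.
Proof.
move=> + v_nz; elim: d us => [|d IHd] [|u us] //= us_d us_sep.
- by exists (@DHomog n F 0 1 (dhomog1 _ _)); rewrite /= meval1 oner_neq0.
- have [g [g_v _]] := IHd [::] isT (fun _ h => False_ind _ (notF h)).
  have [i v_i] : exists i, v 0 i != 0 by apply/rV0Pn.
  have h_homog : 'X_i * (g : {mpoly F[n]}) \is d.+1.-homog.
    by rewrite -add1n dhomogM ?dhomogX /= ?mdeg1 // dhomog_is_dhomog.
  by exists (DHomog h_homog); rewrite /= mevalM mevalXU mulf_neq0.
have [u_nz uv] := us_sep u (mem_head _ _).
have [|g [g_v g_us]] := IHd us us_d.
  by move=> w w_us; apply: us_sep; rewrite inE w_us orbT.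
have [L [L_u L_v]] := sep_linear_form u_nz v_nz uv.
have h_homog : (L : {mpoly F[n]}) * (g : {mpoly F[n]}) \is d.+1.-homog.
  exact: dhomogM (dhomog_is_dhomog L) (dhomog_is_dhomog g).
exists (DHomog h_homog); rewrite /= mevalM mulf_neq0 //; split=> // w.
rewrite inE mevalM => /predU1P[->|/g_us ->]; last by rewrite mulr0.
by rewrite L_u mul0r.
Qed.

(** * Evaluation of forms at finitely many points *)

Definition eval_at (F : fieldType) n d t (vs : 'I_t -> 'rV[F]_n.+1)
    (p : dhomog n.+1 F d) : 'rV[F]_t :=
  \row_i (p : {mpoly F[n.+1]}).@[vs i 0].

Lemma eval_at_linear (F : fieldType) n d t (vs : 'I_t -> 'rV[F]_n.+1) :
  linear (@eval_at F n d t vs).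
Proof.
by move=> a p q; apply/rowP=> i; rewrite !mxE /= mevalD mevalZ.
Qed.

HB.instance Definition _ (F : fieldType) n d t (vs : 'I_t -> 'rV[F]_n.+1) :=
  GRing.isLinear.Build F (dhomog n.+1 F d) 'rV[F]_t _ (@eval_at F n d t vs)
    (eval_at_linear vs).

Lemma mem_lker_eval_at (F : fieldType) n d t (vs : 'I_t -> 'rV[F]_n.+1)
    (p : dhomog n.+1 F d) :
  (p \in lker (linfun (@eval_at F n d t vs))) =
  [forall i, (p : {mpoly F[n.+1]}).@[vs i 0] == 0].
Proof.
rewrite memv_ker lfunE /=; apply/eqP/forallP => [p0 i|p0].
  by have /rowP/(_ i) := p0; rewrite !mxE => ->.
by apply/rowP=> i; rewrite !mxE; apply/eqP.
Qed.

Lemma dim_dhomog (F : fieldType) m d :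
  \dim (fullv : {vspace dhomog m.+1 F d}) = 'C(m + d, d).
Proof. by rewrite dimvf addnC. Qed.

(** Rank-nullity: the image lies in a space of dimension [t]. *)
Lemma dim_lker_eval_at (F : fieldType) m d t (vs : 'I_t -> 'rV[F]_m.+1) :
  ('C(m + d, d) - t <= \dim (lker (linfun (@eval_at F m d t vs))))%N.
Proof.
rewrite -(dim_dhomog F) -(limg_ker_dim (linfun (@eval_at F m d t vs)) fullv)
  capfv.
rewrite leq_subLR addnC leq_add2r.
by rewrite (leq_trans (dimvS (subvf _))) // dimvf dim_matrix mul1r.
Qed.

Lemma eval_at_surj (F : finFieldType) m d t (vs : 'I_t -> 'rV[F]_m.+1) :
    (t <= d.+1)%N -> (forall i, vs i != 0) ->
    (forall i j, i != j -> ~~ proportional (vs i) (vs j)) ->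
  limg (linfun (@eval_at F m d t vs)) = fullv.
Proof.
move=> t_le vs_nz vs_sep; apply/eqP; rewrite eqEsubv subvf /=.
apply/subvP=> w _; rewrite (row_sum_delta w); apply: memv_suml => i _.
apply: memvZ.
set us := [seq vs j | j in predC1 i].
have us_size : (size us <= d)%N.
  by rewrite size_map -cardE cardC1 card_ord; case: (t) t_le.
have us_sep : {in us, forall u : 'rV_m.+1, u != 0 /\ ~~ proportional u (vs i)}.
  by move=> _ /imageP[j ji ->]; split; [apply: vs_nz | apply: vs_sep].
have [g [g_i g_0]] := sep_form us_size (vs_nz i) us_sep.
(* The form [g] kills the other t - 1 <= d points; dividing it by its value at [vs i] hits the i-th
   basis row. *)
have -> : delta_mx 0 i = linfun (@eval_at F m d t vs)
    ((g : {mpoly F[m.+1]}).@[vs i 0]^-1 *: g).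
  rewrite lfunE linearZ /=; apply/rowP=> j; rewrite !mxE eqxx /=.
  have [->|ji] := eqVneq j i; first by rewrite mulVf.
  by rewrite (g_0 (vs j)) ?mulr0 //; apply/imageP; exists j.
exact/memv_img/memvf.
Qed.

(** By surjectivity the kernel of evaluation has codimension exactly [t], and it contains the free
    family [f]. *)
Lemma size_free_vanishing (F : finFieldType) m d t (vs : 'I_t -> 'rV[F]_m.+1)
    (f : seq (dhomog m.+1 F d)) :
    (t <= d.+1)%N -> (forall i, vs i != 0) ->
    (forall i j, i != j -> ~~ proportional (vs i) (vs j)) ->
    free f ->
    {in f, forall (p : dhomog m.+1 F d) i,
      (p : {mpoly F[m.+1]}).@[vs i 0] = 0} ->
  (size f + t <= 'C(m + d, d))%N.
Proof.
move=> t_le vs_nz vs_sep f_free f_0.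
rewrite -(dim_dhomog F) -(limg_ker_dim (linfun (@eval_at F m d t vs)) fullv)
  capfv.
rewrite eval_at_surj // dimvf dim_matrix mul1r leq_add2r -(eqP f_free).
apply/dimvS/span_subvP=> p p_f; rewrite mem_lker_eval_at.
by apply/forallP=> i; rewrite f_0.
Qed.

(** * Projective points and their representatives *)

Lemma proj_spaceP (F : finFieldType) m (P : {set 'rV[F]_m.+1}) :
  reflect (exists2 v, v != 0 & P = [set w | proportional v w])
          (P \in proj_space F m).
Proof.
(* Nonzero multiples of a nonzero vector are nonzero, so the class among nonzero vectors is the full
   proportionality class. *)
have nz_class v : v != 0 :> 'rV[F]_m.+1 ->
    [set w in [set w | w != 0] | proportional v w] =
    [set w | proportional v w].
  move=> v_nz; apply/setP=> w; rewrite !inE andb_idl //.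
  by case/existsP=> a /andP[a_nz /eqP ->]; rewrite scaler_eq0 negb_or a_nz.
apply: (iffP imsetP) => -[v]; rewrite ?inE => v_nz ->; exists v => //.
- by rewrite nz_class.
- by rewrite inE.
- by rewrite nz_class.
Qed.

Lemma proj_space_class (F : finFieldType) m (P : {set 'rV[F]_m.+1}) v :
  P \in proj_space F m -> v \in P -> v != 0 /\ P = [set w | proportional v w].
Proof.
case/proj_spaceP=> u u_nz -> {P}; rewrite inE => uv; split.
  by case/existsP: uv => a /andP[a_nz /eqP ->]; rewrite scaler_eq0 negb_or a_nz.
apply/setP=> w; rewrite !inE.
exact: proportional_left_trans uv w.
Qed.

Lemma proj_space_repr (F : finFieldType) m (P : {set 'rV[F]_m.+1}) :
  P \in proj_space F m -> exists v, v \in P.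
Proof.
by case/proj_spaceP=> v _ ->; exists v; rewrite inE proportional_refl.
Qed.

(** Proportional representatives would lie in the same class, contradicting injectivity of [P]. *)
Lemma proj_space_reprs (F : finFieldType) m t
    (P : 'I_t -> {set 'rV[F]_m.+1}) :
    (forall i, P i \in proj_space F m) -> injective P ->
  exists vs : 'I_t -> 'rV[F]_m.+1,
    [/\ forall i, vs i \in P i, forall i, vs i != 0
      & forall i j, i != j -> ~~ proportional (vs i) (vs j)].
Proof.
move=> P_proj P_inj.
have [vs vs_P] := fin_all_exists (fun i => proj_space_repr (P_proj i)).
exists vs; split=> // [i|i j].
  by have [] := proj_space_class (P_proj i) (vs_P i).
apply: contraNN => vs_ij; apply/eqP/P_inj.
have [_ P_i] := proj_space_class (P_proj i) (vs_P i).
have vs_j : vs j \in P i by rewrite P_i inE.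
have [_ ->] := proj_space_class (P_proj i) vs_j.
by have [_ <-] := proj_space_class (P_proj j) (vs_P j).
Qed.

Lemma inj_points (T : finType) (A : {set T}) t : (t <= #|A|)%N ->
  exists2 P : 'I_t -> T, injective P & forall i, P i \in A.
Proof.
move=> t_le; exists (fun i => enum_val (widen_ord t_le i)) => [i j|i].
  by move=> /enum_val_inj/(congr1 val) /= /val_inj.
exact: enum_valP.
Qed.

Lemma card_proj_space_ge (F : finFieldType) m :
  (0 < m)%N -> (#|F| <= #|proj_space F m|)%N.
Proof.
move=> m_gt0; pose v (a : F) : 'rV[F]_m.+1 := \row_j (if j == 0 then 1 else a).
have v_nz a : v a != 0.
  by apply/rV0Pn; exists 0; rewrite mxE eqxx oner_neq0.
pose C a := [set w | proportional (v a) w].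
have C_inj : injective C.
  move=> a b Cab; have : v b \in C a.
    by rewrite Cab inE proportional_refl.
  (* The points are (1 : a : ... : a). Coordinate 0 forces c = 1; coordinate 1, which exists as m >
     0, then gives a = b. *)
  rewrite inE => /existsP[c /andP[_ /eqP/rowP vb]].
  have := vb 0; have := vb (Ordinal (m_gt0 : 1 < m.+1)%N).
  by rewrite !mxE /= mulr1 => -> <-; rewrite mul1r.
rewrite -(card_imset predT C_inj) subset_leq_card //.
by apply/subsetP=> _ /imsetP[a _ ->]; apply/proj_spaceP; exists (v a).
Qed.

(** * Upper and lower bounds for the number of common zeros *)

Lemma card_common_zeros_le (F : finFieldType) m d s
    (f : ('C(m + d, d) - s).-tuple (dhomog m.+1 F d)) :
  (s <= d)%N -> (s < 'C(m + d, d))%N -> free f -> (#|common_zeros f| <= s)%N.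
Proof.
move=> s_le s_lt f_free; rewrite leqNgt; apply/negP=> /inj_points[P P_inj P_f].
have P_proj i : P i \in proj_space F m by have := P_f i; rewrite inE => /andP[].
have [vs [vs_P vs_nz vs_sep]] := proj_space_reprs P_proj P_inj.
(* With k = 'C(m + d, d) and [size f] equal to k - s, where s < k, this reads k + 1 <= k. *)
suff : (size f + s.+1 <= 'C(m + d, d))%N.
  by rewrite size_tuple addnS subnK ?ltnn // ltnW.
apply: (size_free_vanishing _ vs_nz vs_sep f_free) => // _ /tnthP[j ->] i.
have := P_f i; rewrite inE => /andP[_ /forallP/(_ (vs i))/implyP].
by move=> /(_ (vs_P i)) /forallP/(_ j)/eqP.
Qed.

Lemma exists_common_zeros_ge (F : finFieldType) m d s :
    (0 < m)%N -> (s <= #|F|)%N ->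
  exists2 f : ('C(m + d, d) - s).-tuple (dhomog m.+1 F d),
    free f & (s <= #|common_zeros f|)%N.
Proof.
move=> m_gt0 s_le.
have [P P_inj P_proj] :=
  inj_points (leq_trans s_le (card_proj_space_ge F m_gt0)).
have [vs [vs_P _ _]] := proj_space_reprs P_proj P_inj.
set r := ('C(m + d, d) - s)%N.
pose K := lker (linfun (@eval_at F m d s vs)).
(* The kernel [K] has dimension at least [r], so a basis of it supplies [r] independent forms
   vanishing at the chosen points. *)
have r_size : size (take r (vbasis K)) == r.
  by rewrite size_takel // size_tuple dim_lker_eval_at.
exists (Tuple r_size) => /=.
  have := basis_free (vbasisP K).
  by rewrite -{1}(cat_take_drop r (vbasis K)); apply: catl_free.
rewrite -[leqLHS]card_ord -(card_imset predT P_inj) subset_leq_card //.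
apply/subsetP=> _ /imsetP[i _ ->]; rewrite inE P_proj /=.
apply/forallP=> w; apply/implyP=> w_P; apply/forallP=> j.
have [_ P_i] := proj_space_class (P_proj i) (vs_P i).
move: w_P; rewrite P_i inE => /existsP[a /andP[_ /eqP ->]].
have := mem_tnth j (Tuple r_size) => /mem_take/vbasis_mem.
rewrite mem_lker_eval_at => /forallP/(_ i)/eqP f_0.
by rewrite mevalZ_homog f_0 mulr0.
Qed.

Lemma max_common_zeros_last (F : finFieldType) m d s :
    (0 < m)%N -> (s <= d)%N -> (s <= #|F|)%N -> (s < 'C(m + d, d))%N ->
  max_common_zeros F d m ('C(m + d, d) - s) = s.
Proof.
move=> m_gt0 s_le s_F s_lt; apply/eqP; rewrite eqn_leq; apply/andP; split.
  by apply/bigmax_leqP=> f f_free; apply: card_common_zeros_le.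
have [f f_free f_ge] := exists_common_zeros_ge d m_gt0 s_F.
(* The same system, retyped so as to be an index of the finite maximum. *)
pose f' : _.-tuple (finvect_type (dhomog m.+1 F d)) := f.
by rewrite /max_common_zeros (bigD1 f') //= leq_max f_ge.
Qed.

Close Scope ring_scope.

Theorem theorem4p7 (F : finFieldType) (m d : nat)
    (m_gt0 : (0 < m)%N) (d_gt0 : (1 <= d)%N) (d_lt : (d < #|F| - 1)%N) :
  let k := 'C(m + d, d) in
  (forall s : nat, (s <= d)%N ->
     max_common_zeros F d m (k - s)%N = s /\ TB #|F| d m (k - s)%N = Posz s) /\
  (forall s : nat, (s <= d)%N -> Tsfasman_Boguslavsky F d m (k - s)%N).
Proof.
move=> k.
have both s : s <= d ->
    max_common_zeros F d m (k - s) = s /\ TB #|F| d m (k - s) = Posz s.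
  move=> s_le.
  have d_F : d <= #|F| by rewrite (leq_trans (ltnW d_lt)) ?leq_subr.
  split; last by rewrite /k -(prednK m_gt0) TB_last.
  apply: max_common_zeros_last; rewrite ?(leq_trans s_le) //.
  (* Here d + 1 = 'C(d + 1, d) <= 'C(m + d, d) since m >= 1, whence s < k. *)
  by rewrite (leq_ltn_trans s_le) // -{1}binSn leq_bin2l // -add1n leq_add2r.
by split=> // s /both[]; rewrite /Tsfasman_Boguslavsky => -> ->.
Qed.
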